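(* Let $\Omega$ be a finite set, let $H \le \mathrm{Sym}(\Omega)$, let $\alpha,\beta\in\Omega$ be distinct, and let $\Gamma=\Gamma(H,\Omega,(\alpha,\beta))$ be the orbital graph of $H$ with base-pair $(\alpha,\beta)$. Then $\Gamma$ is futile if and only if $\Gamma$ has a unique connected component $\Delta$ of size at least $2$ and moreover one of the following holds: (a) $\Delta$ is a complete bipartite digraph, or (b) $\Delta$ is a complete digraph.
   Context: Permutations act on the right: $\omega^h$ is the image of $\omega\in\Omega$ under $h$. A digraph is a pair $(V,A)$ of vertices and arcs (ordered pairs of vertices), with no loops and no multiple arcs. The orbital graph $\Gamma(H,\Omega,(\alpha,\beta))$ is the digraph with vertex set $\Omega$ and arc set $A=\{(\alpha^h,\beta^h)\mid h\in H\}$. Connected components are those of the underlying undirected graph; the size of a connected component is its number of vertices. A digraph with vertex set $V$ is complete if its arc set is exactly $\{(\omega_1,\omega_2)\mid \omega_1,\omega_2\in V,\ \omega_1\ne\omega_2\}$. It is a complete bipartite digraph if there are disjoint subsets $S,E$ of $V$ with $V=S\cup E$ and arc set exactly $\{(\omega_1,\omega_2)\mid \omega_1\in S,\ \omega_2\in E\}$ (arcs go only from $S$ to $E$). An ordered orbit partition $P$ of $H$ is an ordered list whose cells are exactly the orbits of $H$ on $\Omega$. $\mathrm{Sym}(P)\le \mathrm{Sym}(\Omega)$ denotes the stabilizer of the ordered partition $P$, i.e. the group of all permutations that stabilize every $H$-orbit as a set (the direct product of the full symmetric groups on the $H$-orbits). The orbital graph $\Gamma$ is futile if $\mathrm{Sym}(P)$,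 in its natural action on $\Omega$, acts by graph automorphisms on $\Gamma$, i.e. for all $g\in \mathrm{Sym}(P)$ and $\gamma,\delta\in\Omega$: $(\gamma,\delta)\in A$ if and only if $(\gamma^g,\delta^g)\in A$. (This does not depend on the ordering of the cells of $P$.) *)

(* Defs.v *)
From mathcomp Require Import all_boot all_fingroup.

Set Implicit Arguments.
Unset Strict Implicit.
Unset Printing Implicit Defensive.

Record digraph (T : finType) := Digraph {
  vertices : {set T};
  arcs : {set T * T};
  arcs_sub : arcs \subset setX vertices vertices;
  arcs_loopless : forall x, (x, x) \notin arcs
}.

Definition underlying_adj (T : finType) (G : digraph T) : rel T :=
  [rel x y | ((x, y) \in arcs G) || ((y, x) \in arcs G)].

(* Vertex sets of the connected components. *)
Definition components (T : finType) (G : digraph T) : {set {set T}} :=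
  equivalence_partition (connect (underlying_adj G)) (vertices G).

Section Induced.

Variables (T : finType) (G : digraph T) (D : {set T}).

Let ivertices := vertices G :&: D.
Let iarcs := arcs G :&: setX D D.

Fact induced_sub : iarcs \subset setX ivertices ivertices.
Proof.
apply/subsetP => -[x y]; rewrite !inE /= => /andP[xyG /andP[-> ->]].
by move/subsetP: (arcs_sub G) => /(_ _ xyG); rewrite !inE !andbT.
Qed.

Fact induced_loopless x : (x, x) \notin iarcs.
Proof. by rewrite inE (negPf (arcs_loopless G x)). Qed.

Definition induced : digraph T := Digraph induced_sub induced_loopless.

End Induced.

Definition complete (T : finType) (G : digraph T) : Prop :=
  arcs G = [set p in setX (vertices G) (vertices G) | p.1 != p.2].

Definition complete_bipartite (T : finType) (G : digraph T) : Prop :=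
  exists S E : {set T},
    [/\ [disjoint S & E], vertices G = S :|: E & arcs G = setX S E].

Section OrbitalGraph.

Variables (T : finType) (H : {group {perm T}}) (a b : T).
Hypothesis neq_ab : a != b.

Let oarcs := [set (h a, h b) | h : {perm T} in H].

Fact orbital_sub : oarcs \subset setX [set: T] [set: T].
Proof. by apply/subsetP => p _; rewrite !inE. Qed.

Fact orbital_loopless x : (x, x) \notin oarcs.
Proof.
apply/imsetP => -[h _ [xa xb]]; case/eqP: neq_ab.
by apply: (@perm_inj _ h); rewrite -xa -xb.
Qed.

Definition orbital_graph : digraph T := Digraph orbital_sub orbital_loopless.

End OrbitalGraph.

Definition ordered_orbit_partition (T : finType) (H : {group {perm T}})
    (P : seq {set T}) : Prop :=
  uniq P /\ P =i [set orbit 'P H x | x : T].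

(* The cells are moved pointwise and compared in order, so each cell is fixed
   setwise. *)
Definition sym_partition (T : finType) (P : seq {set T}) : {set {perm T}} :=
  [set g : {perm T} | [seq g @: C | C : {set T} <- P] == P].

(* P is to be an ordered orbit partition of the group defining G. *)
Definition futile (T : finType) (P : seq {set T}) (G : digraph T) : Prop :=
  forall g : {perm T}, g \in sym_partition P ->
  forall x y : T, (x, y) \in arcs G <-> (g x, g y) \in arcs G.

(* Main.v *)
Require Import Defs.
From mathcomp Require Import all_boot all_fingroup.

Set Implicit Arguments.
Unset Strict Implicit.
Unset Printing Implicit Defensive.

(** Write [A] and [B] for the orbits of [a] and [b]. The orbital graph is futile
    exactly when every pair in [A * B] off the diagonal is an arc
    ([futile_arcsP]). Arcs always lie in [A * B] off the diagonal, and the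
    permutations that preserve every orbit move [(a, b)] to any such pair, as two
    transpositions suffice; conversely, they preserve [A], [B] and the diagonal.

    Two orbits are equal or disjoint. If [A = B] these pairs form a complete
    digraph on [A], and if [A] and [B] are disjoint they form a complete bipartite
    digraph. In both cases [A :|: B] is connected and the other vertices are
    isolated ([offdiag_large_component]). In the other direction, an arc lies in
    a component with at least two vertices, so when that component is unique it
    contains all the arcs ([arcs_in_large_component]); since the sources of arcs
    fill [A] and the targets fill [B], its two sides can only be [A] and [B]
    ([orbital_bipartite]), or both orbits equal its vertex set in the complete case
    ([orbital_complete]). *)

(** One formula covers the complete digraph ([A = B]) and the complete bipartite
    one ([A], [B] disjoint), so that the group theory needs no case distinction. *)
Definition offdiag (T : finType) (A B : {set T}) : {set T * T} :=
  [set p in setX A B | p.1 != p.2].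

Lemma in_offdiag (T : finType) (A B : {set T}) x y :
  ((x, y) \in offdiag A B) = [&& x \in A, y \in B & x != y].
Proof. by rewrite !inE andbA. Qed.

Lemma offdiag_disjoint (T : finType) (A B : {set T}) :
  [disjoint A & B] -> offdiag A B = setX A B.
Proof.
move=> dAB; apply/setP => -[x y]; rewrite in_offdiag in_setX.
case xA: (x \in A) => //=; case yB: (y \in B) => //=.
by apply: contraTneq yB => <-; rewrite (disjointFr dAB xA).
Qed.

(** * Components of a digraph *)

Definition large_component (T : finType) (G : digraph T) (C : {set T}) : Prop :=
  C \in components G /\ 2 <= #|C|.

Lemma arc_endpoints (T : finType) (G : digraph T) x y :
  (x, y) \in arcs G -> [/\ x \in vertices G, y \in vertices G & x != y].
Proof.
move=> xyG; move/subsetP: (arcs_sub G) => /(_ _ xyG).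
rewrite in_setX => /andP[-> ->]; split=> //.
by apply: contraTneq xyG => ->; apply: arcs_loopless.
Qed.

Lemma arcs_in_large_component (T : finType) (G : digraph T) (D : {set T}) :
  unique (large_component G) D -> arcs (induced G D) = arcs G.
Proof.
move=> [_ uniD]; apply/setIidPl/subsetP => -[x y] xyG.
have [xV yV neq_xy] := arc_endpoints xyG.
pose C := [set z in vertices G | connect (underlying_adj G) x z].
have xC : x \in C by rewrite inE xV connect0.
have yC : y \in C by rewrite inE yV connect1 // /underlying_adj /= xyG.
rewrite (uniD C) ?in_setX ?xC ?yC //; split; first exact: imset_f.
by apply/card_gt1P; exists x, y.
Qed.

(** Every vertex of [A :|: B] is joined to [a] by a walk of length at most 2: a
    target is reached from [a] itself, and a source other than [b] through [b]. A
    vertex outside has no neighbour, so its component is a singleton. *)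
Lemma offdiag_large_component (T : finType) (G : digraph T) (A B : {set T})
    (a b : T) :
    arcs G = offdiag A B -> a \in A -> b \in B -> a != b ->
  unique (large_component G) (A :|: B).
Proof.
move=> arcsG aA bB neq_ab; set e := underlying_adj G.
have adjE x y : e x y = ((x, y) \in offdiag A B) || ((y, x) \in offdiag A B).
  by rewrite /e /underlying_adj /= arcsG.
have symE : symmetric e by move=> x y; rewrite !adjE orbC.
have symC : connect_sym e := sym_connect_sym symE.
have arcsV x y :
    (x, y) \in offdiag A B -> (x \in vertices G) && (y \in vertices G).
  by rewrite -arcsG => /arc_endpoints[-> ->].
have toA x : x \in A :|: B -> connect e a x && (x \in vertices G).
  have abG : (a, b) \in offdiag A B by rewrite in_offdiag aA bB.
  have e_ab : connect e a b by rewrite connect1 // adjE abG.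
  have /andP[aV bV] := arcsV _ _ abG.
  have [<-|neq_ax] := eqVneq a x; first by rewrite connect0 aV.
  have [<-|neq_bx] := eqVneq b x; first by rewrite e_ab bV.
  case/setUP => [xA|xB].
    have xbG : (x, b) \in offdiag A B by rewrite in_offdiag xA bB eq_sym.
    case/andP: (arcsV _ _ xbG) => -> _; rewrite andbT (connect_trans e_ab) //.
    by rewrite connect1 // adjE xbG orbT.
  have axG : (a, x) \in offdiag A B by rewrite in_offdiag aA xB.
  by case/andP: (arcsV _ _ axG) => _ ->; rewrite connect1 // adjE axG.
have eAB x y : e x y -> x \in A :|: B.
  rewrite adjE !in_offdiag in_setU.
  by case/orP=> /and3P[xA yB _]; rewrite ?xA ?yB ?orbT.
have closedAB : closed e (A :|: B).
  by apply: intro_closed => // x y; rewrite symE => /eAB.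
have compAB x : x \in A :|: B ->
    [set y in vertices G | connect e x y] = A :|: B.
  move=> xAB; apply/setP => y; rewrite inE.
  apply/andP/idP => [[_ /(closed_connect closedAB) <-] //|/toA/andP[ay ->]].
  by have /andP[ax _] := toA x xAB; rewrite (connect_trans _ ay) // symC.
have aAB : a \in A :|: B by rewrite in_setU aA.
have bAB : b \in A :|: B by rewrite in_setU bB orbT.
split; first split.
- by rewrite -(compAB a aAB); apply: imset_f; case/andP: (toA a aAB).
- by apply/card_gt1P; exists a, b.
move=> C [/imsetP[x _ ->]]; have [/compAB-> //|xAB] := boolP (x \in A :|: B).
case/card_gt1P=> y [z] []; rewrite !inE => /andP[_ xy] /andP[_ xz].
have isolated u : connect e x u -> x = u.
  by case/connectP => -[|v p] //= /andP[/eAB xAB' _]; rewrite xAB' in xAB.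
by rewrite -(isolated y xy) -(isolated z xz) eqxx.
Qed.

(** * Permutations that preserve every orbit *)

Lemma sym_orbit_partitionP (T : finType) (H : {group {perm T}})
    (P : seq {set T}) (g : {perm T}) :
    ordered_orbit_partition H P ->
  reflect (forall x, g x \in orbit 'P H x) (g \in sym_partition P).
Proof.
move=> [_ cellsP]; rewrite inE; apply: (iffP eqP) => [fixP x|fixO].
  have := fixP; rewrite -[RHS]map_id => /eq_in_map fixC.
  have xP : orbit 'P H x \in P by rewrite cellsP imset_f.
  by have := fixC _ xP; rewrite /= => <-; apply: imset_f; apply: orbit_refl.
rewrite -[RHS]map_id; apply/eq_in_map => C; rewrite cellsP => /imsetP[x _ ->].
(* An injective map that sends a finite set into itself maps onto it. *)
apply/eqP; rewrite eqEcard (card_imset _ (@perm_inj _ g)) leqnn andbT.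
apply/subsetP => _ /imsetP[y xy ->].
by rewrite -(orbit_eqP xy) fixO.
Qed.

Lemma tperm_orbit (T : finType) (H : {group {perm T}}) (x y z : T) :
  y \in orbit 'P H x -> tperm x y z \in orbit 'P H z.
Proof.
by move=> xy; case: tpermP => [->|->|_ _] //; rewrite ?orbit_refl // orbit_sym.
Qed.

(** Two transpositions suffice: the first sends [a] to [x], and the second moves
    the new image of [b] to [y] without displacing [x]. *)
Lemma orbit_preserving_move (T : finType) (H : {group {perm T}}) (a b x y : T) :
    a != b -> (x, y) \in offdiag (orbit 'P H a) (orbit 'P H b) ->
  exists g : {perm T},
    [/\ forall z, g z \in orbit 'P H z, g a = x & g b = y].
Proof.
move=> neq_ab; rewrite in_offdiag => /and3P[ax byO neq_xy].
pose c := tperm a x b.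
have cb : c \in orbit 'P H b by apply: tperm_orbit.
have cy : y \in orbit 'P H c by rewrite (orbit_eqP cb).
have neq_cx : c != x.
  by rewrite -[X in _ != X](tpermL a x) (inj_eq perm_inj) eq_sym.
exists (tperm a x * tperm c y)%g; split=> [z||]; rewrite permM.
- have zO : tperm a x z \in orbit 'P H z by apply: tperm_orbit.
  by rewrite -(orbit_eqP zO) tperm_orbit.
- by rewrite tpermL tpermD // eq_sym.
- by rewrite tpermL.
Qed.

(** * Arcs of an orbital graph *)

Lemma orbital_arcs_sub (T : finType) (H : {group {perm T}}) (a b : T)
    (neq_ab : a != b) :
  arcs (orbital_graph H neq_ab) \subset offdiag (orbit 'P H a) (orbit 'P H b).
Proof.
apply/subsetP => _ /imsetP[h hH ->].
by rewrite in_offdiag (inj_eq perm_inj) neq_ab !(mem_orbit 'P _ hH).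
Qed.

Lemma orbital_base_arc (T : finType) (H : {group {perm T}}) (a b : T)
    (neq_ab : a != b) :
  (a, b) \in arcs (orbital_graph H neq_ab).
Proof. by apply/imsetP; exists 1%g; rewrite ?perm1. Qed.

Lemma orbital_sourceP (T : finType) (H : {group {perm T}}) (a b : T)
    (neq_ab : a != b) x :
  reflect (exists y, (x, y) \in arcs (orbital_graph H neq_ab))
          (x \in orbit 'P H a).
Proof.
apply: (iffP idP) => [/orbitP[h hH <-]|[y]].
  by exists (h b); apply/imsetP; exists h.
by move/(subsetP (orbital_arcs_sub H neq_ab)); rewrite in_offdiag => /and3P[].
Qed.

Lemma orbital_targetP (T : finType) (H : {group {perm T}}) (a b : T)
    (neq_ab : a != b) y :
  reflect (exists x, (x, y) \in arcs (orbital_graph H neq_ab))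
          (y \in orbit 'P H b).
Proof.
apply: (iffP idP) => [/orbitP[h hH <-]|[x]].
  by exists (h a); apply/imsetP; exists h.
by move/(subsetP (orbital_arcs_sub H neq_ab)); rewrite in_offdiag => /and3P[].
Qed.

Lemma futile_arcsP (T : finType) (H : {group {perm T}}) (P : seq {set T})
    (a b : T) (neq_ab : a != b) :
    ordered_orbit_partition H P ->
  futile P (orbital_graph H neq_ab) <->
  arcs (orbital_graph H neq_ab) = offdiag (orbit 'P H a) (orbit 'P H b).
Proof.
move=> hP; split=> [fut|arcsG].
  apply/eqP; rewrite eqEsubset orbital_arcs_sub; apply/subsetP => -[x y].
  move/(orbit_preserving_move neq_ab) => [g [gP <- <-]].
  apply/(fut g _ a b); [exact/(sym_orbit_partitionP _ hP) |].
  exact: orbital_base_arc.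
move=> g /(sym_orbit_partitionP _ hP) gP x y; rewrite arcsG !in_offdiag.
have fixO z t : (g t \in orbit 'P H z) = (t \in orbit 'P H z).
  by rewrite ![_ \in orbit _ _ z]orbit_sym (orbit_eqP (gP t)).
by rewrite !fixO (inj_eq perm_inj).
Qed.

Lemma orbital_bipartite (T : finType) (H : {group {perm T}}) (a b : T)
    (neq_ab : a != b) (S E : {set T}) :
    [disjoint S & E] -> arcs (orbital_graph H neq_ab) = setX S E ->
  arcs (orbital_graph H neq_ab) = offdiag (orbit 'P H a) (orbit 'P H b).
Proof.
move=> dSE arcsG; have := orbital_base_arc H neq_ab.
rewrite arcsG in_setX => /andP[aS bE].
suff [-> ->] : orbit 'P H a = S /\ orbit 'P H b = E by rewrite offdiag_disjoint.
split; apply/setP => x.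
  apply/(orbital_sourceP _ neq_ab)/idP => [[y]|xS].
    by rewrite arcsG in_setX => /andP[].
  by exists b; rewrite arcsG in_setX xS.
apply/(orbital_targetP _ neq_ab)/idP => [[y]|xE].
  by rewrite arcsG in_setX => /andP[].
by exists a; rewrite arcsG in_setX aS.
Qed.

Lemma orbital_complete (T : finType) (H : {group {perm T}}) (a b : T)
    (neq_ab : a != b) (D : {set T}) :
    arcs (orbital_graph H neq_ab) = offdiag D D ->
  arcs (orbital_graph H neq_ab) = offdiag (orbit 'P H a) (orbit 'P H b).
Proof.
move=> arcsG; have := orbital_base_arc H neq_ab.
rewrite arcsG in_offdiag => /and3P[aD bD _].
(* A vertex of D is adjacent both ways to a or to b, whichever it is not. *)
have other x : exists2 y, y \in D & x != y.
  by have [->|] := eqVneq x a; [exists b | exists a].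
suff [-> ->] : orbit 'P H a = D /\ orbit 'P H b = D by [].
split; apply/setP => x.
  apply/(orbital_sourceP _ neq_ab)/idP => [[y]|xD].
    by rewrite arcsG in_offdiag => /and3P[].
  by have [y yD neq_xy] := other x; exists y; rewrite arcsG in_offdiag xD yD.
apply/(orbital_targetP _ neq_ab)/idP => [[y]|xD].
  by rewrite arcsG in_offdiag => /and3P[].
have [y yD neq_xy] := other x.
by exists y; rewrite arcsG in_offdiag xD yD eq_sym.
Qed.

(** * The characterisation of futile orbital graphs *)

Theorem theorem22 (T : finType) (H : {group {perm T}}) (P : seq {set T})
    (hP : ordered_orbit_partition H P) (a b : T) (neq_ab : a != b) :
  let Gamma := orbital_graph H neq_ab in
  futile P Gamma <->
  exists D : {set T},
    unique (fun C : {set T} => C \in components Gamma /\ 2 <= #|C|) D /\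
    (complete_bipartite (induced Gamma D) \/ complete (induced Gamma D)).
Proof.
move=> Gamma; apply: iff_trans (futile_arcsP neq_ab hP) _; rewrite -/Gamma.
set A := orbit 'P H a; set B := orbit 'P H b.
have vertD C : vertices (induced Gamma C) = C by apply: setTI.
split=> [arcsG|[D [uniD shape]]].
  have uniAB : unique (large_component Gamma) (A :|: B).
    exact: (offdiag_large_component arcsG (orbit_refl _ _ _)
                                     (orbit_refl _ _ _)).
  exists (A :|: B); split=> //; have arcsD := arcs_in_large_component uniAB.
  have [eqAB|neqAB] := eqVneq A B.
    by right; rewrite /complete arcsD arcsG vertD eqAB setUid.
  left; exists A, B.
  have dAB : [disjoint A & B].
    apply: contra_neqT neqAB => /pred0Pn[x /andP[/= xA xB]].
    by rewrite /A /B -(orbit_eqP xA) (orbit_eqP xB).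
  by rewrite arcsD arcsG offdiag_disjoint // vertD.
have arcsD := arcs_in_large_component uniD.
case: shape => [[S [E [dSE _]]]|]; rewrite /complete arcsD.
  by move/(orbital_bipartite dSE).
by rewrite vertD => /orbital_complete.
Qed.
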